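(* Let $d,n\ge1$, let $x_1,\dots,x_n\in\mathbb{R}^d$ be deterministic, $f:\mathbb{R}^d\to\mathbb{R}$, $\sigma>0$, and observe $Y_i=f(x_i)+\sigma\xi_i$, $i=1,\dots,n$, with $\xi_i$ i.i.d. $\mathcal{N}(0,1)$. Let $\mathcal{D}=\{\phi_{a,b}:a\in\mathbb{R}^d,b\in\mathbb{R}\}$ with $\phi_{a,b}(x)=\mathbf{1}\{\langle a,x\rangle+b>0\}$. Assume $$\lambda\ge\frac{28\sigma}{\sqrt n}\Big(\sqrt{\ln((n+1)^{d+1})}+4\Big),$$ and let $\hat f\in\arg\min_{h\in\mathcal{L}_1(\mathcal{D})}\big(\|Y-h\|^2+\lambda\|h\|_{\mathcal{L}_1(\mathcal{D})}\big)$. Then there exists an absolute constant $C>0$ such that $$\mathbb{E}\Big[\|f-\hat f\|^2+\lambda\|\hat f\|_{\mathcal{L}_1(\mathcal{D})}\Big]\le C\Big[\inf_{h\in\mathcal{L}_1(\mathcal{D})}\big(\|f-h\|^2+\lambda\|h\|_{\mathcal{L}_1(\mathcal{D})}\big)+\lambda\frac{\sigma}{\sqrt n}\Big].$$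
   Context: For functions $g,h$ on $\mathbb{R}^d$, $\|h\|^2=\frac1n\sum_{i=1}^nh(x_i)^2$ and $\|Y-h\|^2=\frac1n\sum_{i=1}^n(Y_i-h(x_i))^2$ (functions are identified with their vectors of values at $x_1,\dots,x_n$). $\mathcal{L}_1(\mathcal{D})$ is the linear span of $\mathcal{D}$ with $\|h\|_{\mathcal{L}_1(\mathcal{D})}=\inf\{\sum_{a,b}|\theta_{a,b}|:h=\sum_{a,b}\theta_{a,b}\phi_{a,b}\}$. *)

(* Defs.v *)
From HB Require Import structures.
From mathcomp Require Import all_boot all_order all_algebra.
From mathcomp Require Import all_classical all_reals all_analysis.
Set Implicit Arguments. Unset Strict Implicit. Unset Printing Implicit Defensive.
Import Order.TTheory GRing.Theory Num.Theory.
Local Open Scope classical_set_scope.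
Local Open Scope ring_scope.

(* MathComp + MathComp-Analysis, over an abstract R : realType.
   Functions on R^d are identified with their vectors of values at the design
   points x_1..x_n; such vectors are represented as 'I_n -> R. *)

Section Lasso.
Context {R : realType} {d n : nat}.

Definition inner (a v : 'rV[R]_d) : R := \sum_(j < d) a 0 j * v 0 j.

Definition phi (x : 'I_n -> 'rV[R]_d) (a : 'rV[R]_d) (b : R) : 'I_n -> R :=
  fun i => if 0 < inner a (x i) + b then 1 else 0.

Definition is_repr (x : 'I_n -> 'rV[R]_d) (h : 'I_n -> R) (k : nat)
  (a : 'I_k -> 'rV[R]_d) (b : 'I_k -> R) (th : 'I_k -> R) : Prop :=
  forall i, h i = \sum_(j < k) th j * phi x (a j) (b j) i.

Definition in_L1 (x : 'I_n -> 'rV[R]_d) (h : 'I_n -> R) : Prop :=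
  exists k a b th, @is_repr x h k a b th.

Definition L1norm (x : 'I_n -> 'rV[R]_d) (h : 'I_n -> R) : R :=
  inf [set t : R | exists k a b th, @is_repr x h k a b th /\
                                    t = \sum_(j < k) `|th j|].

Definition sqn (v : 'I_n -> R) : R := n%:R^-1 * \sum_(i < n) v i ^+ 2.

Definition objective (x : 'I_n -> 'rV[R]_d) (lam : R) (y h : 'I_n -> R) : R :=
  sqn (fun i => y i - h i) + lam * L1norm x h.

End Lasso.

(* Main.v *)
(** Let [A h] be the noiseless objective at a competitor [h] and
    [e i = sigma * xi i] the noise.  Comparing the penalized criterion at
    [fhat] and [h], the loss is at most [A h] plus twice the pairing of [e] with
    [fhat - h].  This pairing is at most the largest |<e, phi_{a,b}>| times
    [L1norm fhat + L1norm h].  If all |<e, phi_{a,b}>| are below [lam / 4] the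
    loss is at most [3 * A h].  Without any condition on the noise it is at most
    [3 * A h + 8 * sqn e].  Only [E (sqn e)] over the exceptional event is left;
    there [xi i ^+ 2] is dominated by [2 (exp (xi i) + exp (- xi i))] and the
    indicator of the event by a sum of exponentials of [+- u S - u t], where
    [S] is the sum of [xi] over the trace of a half-space on the design points,
    so that the Gaussian moment generating function bounds everything.  The
    half-space traces number at most [(n + 1) ^ (d + 1)], by Radon's argument
    and Pajor's form of the Sauer-Shelah lemma: a finite family of sets has at
    most as many members as sets it shatters. *)

Require Import Defs.
From HB Require Import structures.
From mathcomp Require Import all_boot all_order all_algebra.
From mathcomp Require Import all_classical all_reals all_analysis.
From mathcomp Require Import measurable_realfun ring lra zify.
Set Implicit Arguments. Unset Strict Implicit. Unset Printing Implicit Defensive.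
Import Order.TTheory GRing.Theory Num.Theory.
Local Open Scope classical_set_scope.
Local Open Scope ring_scope.

Import HBNNSimple.

(** * Integrals of products of independent variables and the Gaussian moment generating function *)

(** Linearity carries the identity from indicators to simple functions, and monotone convergence
    carries it to all nonnegative measurable [f]. With [K] a product of integrals it peels off one
    independent factor; with [G] a density and [K = 1] it is a change of measure. *)
Lemma ge0_integral_indic_ext d1 d2 (T : measurableType d1) (S : measurableType d2)
    (R : realType) (m : {measure set T -> \bar R}) (nu : {measure set S -> \bar R})
    (G : T -> R) (X : T -> S) (K : \bar R) :
  measurable_fun setT X -> measurable_fun setT G ->
  (forall t, 0 <= G t) -> (0 <= K)%E -> K \is a fin_num ->
  (forall B : set S, measurable B ->
     \int[m]_t ((G t)%:E * (\1_B (X t))%:E) = K * nu B)%E ->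
  forall f : S -> \bar R, measurable_fun setT f -> (forall s, 0 <= f s)%E ->
  (\int[m]_t ((G t)%:E * f (X t)) = K * \int[nu]_s f s)%E.
Proof.
move=> mX mG G0 K0 Kfin hB f mf f0.
pose g := nnsfun_approx measurableT mf.
have mGE : measurable_fun setT (EFin \o G) by exact/measurable_EFinP.
have GE0 t : (0 <= (G t)%:E)%E by rewrite lee_fin.
have mgX k : measurable_fun setT (fun t => (g k (X t))%:E).
  by apply/measurable_EFinP; exact: measurableT_comp.
have step k : (\int[m]_t ((G t)%:E * (g k (X t))%:E) = K * \int[nu]_s (g k s)%:E)%E.
  under eq_integral => t _.
    rewrite fimfunE -fsumEFin// ge0_mule_fsumr; last first.
      by move=> r; rewrite EFinM nnfun_muleindic_ge0.
    over.
  rewrite [LHS]ge0_integral_fsum//; last 2 first.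
  - move=> r; apply: emeasurable_funM => //; apply/measurable_EFinP.
    by apply: measurable_funM => //; exact: measurableT_comp.
  - by move=> r t _; rewrite mule_ge0// EFinM nnfun_muleindic_ge0.
  under [in RHS]eq_integral => s _.
    rewrite fimfunE -fsumEFin//.
    over.
  rewrite [in RHS]ge0_integral_fsum//; last 2 first.
  - by move=> r; apply/measurable_EFinP; exact: measurable_funM.
  - by move=> r t _; rewrite EFinM nnfun_muleindic_ge0.
  rewrite ge0_mule_fsumr; last first.
    by move=> r; apply: integral_ge0 => s _; rewrite EFinM nnfun_muleindic_ge0.
  apply: eq_fsbigr => r; rewrite inE => -[s _ <-].
  have gs : (0 <= g k s)%R by [].
  under eq_integral do rewrite EFinM muleCA.
  rewrite ge0_integralZl_EFin//; last 2 first.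
  - by move=> t _; rewrite mule_ge0// lee_fin.
  - apply: emeasurable_funM => //; apply/measurable_EFinP.
    exact: measurableT_comp.
  rewrite hB//.
  under [in RHS]eq_integral do rewrite EFinM.
  rewrite ge0_integralZl_EFin//; last first.
    exact/measurable_EFinP.
  by rewrite integral_indic// setIT muleCA.
have cg s : (g k s)%:E @[k --> \oo] --> f s.
  by apply: (cvg_nnsfun_approx measurableT) => // ? _.
have ndg s : {homo (fun k => (g k s)%:E) : a b / (a <= b)%N >-> (a <= b)%E}.
  by move=> a b ab; rewrite lee_fin; exact/lefP/nd_nnsfun_approx.
have ndG t : {homo (fun k => ((G t)%:E * (g k (X t))%:E)%E) : a b / (a <= b)%N >-> (a <= b)%E}.
  by move=> a b ab; rewrite lee_wpmul2l// ndg.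
have -> : (\int[m]_t ((G t)%:E * f (X t)) =
    limn (fun k => \int[m]_t ((G t)%:E * (g k (X t))%:E)))%E.
  rewrite -monotone_convergence//=.
  - apply: eq_integral => t _; apply/esym/cvg_lim => //.
    by apply: cvgeZl => //; exact: cg.
  - by move=> k; exact: emeasurable_funM.
  - by move=> k t _; rewrite mule_ge0// lee_fin.
under eq_fun do rewrite step.
have -> : (\int[nu]_s f s = limn (fun k => \int[nu]_s (g k s)%:E))%E.
  rewrite -monotone_convergence//=.
  - by apply: eq_integral => s _; apply/esym/cvg_lim => //; exact: cg.
  - by move=> k; exact/measurable_EFinP.
  - by move=> k s _; rewrite lee_fin.
rewrite limeMl//; apply: ereal_nondecreasing_is_cvgn => a b ab.
apply: ge0_le_integral => //.
- by move=> s _; rewrite lee_fin.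
- exact/measurable_EFinP.
- exact/measurable_EFinP.
- by move=> s _; exact: ndg.
Qed.

(** Induction on the number [k] of leading coordinates at which [F i] may be arbitrary, the others
    being indicators. At [k = 0] the claim is the independence hypothesis; the step frees coordinate
    [k] by [ge0_integral_indic_ext]. *)
Lemma integral_prod_independent (R : realType) (d : measure_display)
    (T : measurableType d) (P : probability T R) (n : nat)
    (X : 'I_n -> {RV P >-> R}) (F : 'I_n -> R -> R) :
  (forall B : 'I_n -> set R, (forall i, measurable (B i)) ->
     P (\bigcap_(i in [set: 'I_n]) (X i @^-1` B i)) =
     (\prod_(i < n) P (X i @^-1` B i))%E) ->
  (forall i, measurable_fun setT (F i)) ->
  (forall i x, 0 <= F i x) ->
  (forall i, (\int[distribution P (X i)]_x (F i x)%:E)%E \is a fin_num) ->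
  (\int[P]_w (\prod_(i < n) F i (X i w))%:E =
   \prod_(i < n) \int[distribution P (X i)]_x (F i x)%:E)%E.
Proof.
move=> indep mF F0 Ffin.
suff main k : (forall i : 'I_n, (k <= i)%N ->
      exists2 B : set R, measurable B & F i = \1_B) ->
    (\int[P]_w (\prod_(i < n) F i (X i w))%:E =
     \prod_(i < n) \int[distribution P (X i)]_x (F i x)%:E)%E.
  by apply: (main n) => i; rewrite leqNgt ltn_ord.
elim: k F mF F0 Ffin => [|k IH] F mF F0 Ffin.
  move=> /(_ _ (leq0n _)) FB.
  pose B i := s2val (cid2 (FB i)).
  have mB i : measurable (B i) by exact: (s2valP (cid2 (FB i))).
  have FE i : F i = \1_(B i) by exact: (s2valP' (cid2 (FB i))).
  have mXB i : measurable (X i @^-1` B i) by apply: measurable_funPTI.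
  transitivity (P (\bigcap_(i in [set: 'I_n]) (X i @^-1` B i))).
    rewrite -[X in P X]setIT -integral_indic//; last first.
      by apply: fin_bigcap_measurable => //; exact: finite_finset.
    apply: eq_integral => w _; congr EFin; rewrite indicE.
    under eq_bigr do rewrite FE indicE.
    have [wB|wB] := pselect ((\bigcap_(i in [set: 'I_n]) (X i @^-1` B i)) w).
      rewrite mem_set// big1// => i _.
      by rewrite mem_set//; exact: wB.
    rewrite memNset//; move/existsNP : wB => [i /not_implyP[_ wi]].
    by rewrite (bigD1 i)//= memNset ?mul0r.
  rewrite indep//; apply: eq_bigr => i _.
  by rewrite FE integral_indic// setIT.
move=> FB; have [nk|kn] := leqP n k.
  by apply: IH => // i ki; have := leq_trans nk ki; rewrite leqNgt ltn_ord.
pose j := Ordinal kn.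
rewrite (bigD1 j)//= muleC.
under eq_integral do rewrite (bigD1 j)//= mulrC EFinM.
apply: (@ge0_integral_indic_ext _ _ _ _ _ P (distribution P (X j))
  (fun w => \prod_(i < n | i != j) F i (X i w)) (X j)
  (\prod_(i < n | i != j) \int[distribution P (X i)]_x (F i x)%:E)%E _ _ _ _ _ _ (EFin \o F j)) => //.
- under eq_fun do rewrite -big_filter.
  by apply: measurable_prod => i _; exact: measurableT_comp.
- by move=> w; apply: prodr_ge0 => i _.
- elim/big_ind : _ => [//|x y|i _]; first exact: mule_ge0.
  by apply: integral_ge0 => x _; rewrite lee_fin.
- by elim/big_ind : _ => [//|x y|//]; exact: fin_numM.
- move=> B mB.
  (* With an indicator put at coordinate [j], the induction hypothesis applies and gives the
     identity on indicators that the extension lemma asks for. *)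
  pose F' i := if i == j then \1_B else F i.
  have := IH F'.
  have F'E i : i != j -> F' i = F i by rewrite /F' => /negbTE ->.
  have F'j : F' j = \1_B by rewrite /F' eqxx.
  rewrite (bigD1 j)//= F'j integral_indic// setIT muleC.
  rewrite (eq_bigr (fun i => (\int[distribution P (X i)]_x (F i x)%:E)%E)); last first.
    by move=> i ij; rewrite F'E.
  move=> <-//.
  + apply: eq_integral => w _; rewrite -EFinM; congr EFin.
    rewrite [RHS](bigD1 j)//= F'j mulrC; congr (_ * _).
    by apply: eq_bigr => i ij; rewrite F'E.
  + by move=> i; rewrite /F'; case: ifP.
  + by move=> i x; rewrite /F'; case: ifP.
  + move=> i; rewrite /F'; case: ifP => // _.
    by rewrite integral_indic// setIT fin_num_measure.
  + move=> i ki; rewrite /F'; case: ifPn => [_|ij]; first by exists B.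
    apply: FB; rewrite ltn_neqAle ki andbT; apply: contra ij => /eqP kE.
    by apply/eqP/val_inj.
- exact/measurable_EFinP.
- by move=> x; rewrite /= lee_fin.
Qed.

(** Completing the square: [expR (c * x)] times the N(0,1) density is [expR (c ^+ 2 / 2)] times the
    N(c,1) density, which integrates to 1. *)
Lemma integral_expR_normal (R : realType) (d : measure_display)
    (T : measurableType d) (P : probability T R) (X : {RV P >-> R}) (c : R) :
  (forall B : set R, measurable B -> P (X @^-1` B) = normal_prob 0 1 B) ->
  (\int[distribution P X]_x (expR (c * x))%:E = (expR (c ^+ 2 / 2))%:E)%E.
Proof.
move=> XN.
have mexp : measurable_fun setT (fun x : R => expR (c * x)).
  by apply: measurableT_comp => //; exact: measurable_funM.
rewrite -[LHS]mul1e.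
rewrite -(@ge0_integral_indic_ext _ _ _ _ _ lebesgue_measure (distribution P X)
  (normal_pdf 0 1) id 1%E _ _ _ _ _ _ (fun x => (expR (c * x))%:E))//.
- transitivity (\int[lebesgue_measure]_x
      ((expR (c ^+ 2 / 2))%:E * (normal_pdf c 1 x)%:E))%E.
    apply: eq_integral => x _; rewrite -!EFinM; congr EFin.
    rewrite !normal_pdfE ?oner_eq0// /normal_fun.
    rewrite mulrAC -mulrA -expRD [RHS]mulrCA -expRD; by congr (_ * expR _); field.
  rewrite ge0_integralZl_EFin ?expR_ge0//.
  + by rewrite integral_normal_pdf mule1.
  + by move=> x _; rewrite lee_fin normal_pdf_ge0.
  + by apply/measurable_EFinP; exact: measurable_normal_pdf.
- exact: measurable_normal_pdf.
- by move=> t; exact: normal_pdf_ge0.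
- move=> B mB; rewrite mul1e; apply/esym; apply: etrans (XN B mB) _; rewrite /normal_prob.
  rewrite [LHS]integral_mkcond.
apply: eq_integral => x _.
  by rewrite epatch_indic.
- exact/measurable_EFinP.
Qed.

Lemma integral_expR_sum_normal (R : realType) (d : measure_display)
    (T : measurableType d) (P : probability T R) (n : nat)
    (X : 'I_n -> {RV P >-> R}) (c : 'I_n -> R) :
  (forall i (B : set R), measurable B ->
     P (X i @^-1` B) = normal_prob 0 1 B) ->
  (forall B : 'I_n -> set R, (forall i, measurable (B i)) ->
     P (\bigcap_(i in [set: 'I_n]) (X i @^-1` B i)) =
     (\prod_(i < n) P (X i @^-1` B i))%E) ->
  (\int[P]_w (expR (\sum_(i < n) c i * X i w))%:E =
   (expR (\sum_(i < n) c i ^+ 2 / 2))%:E)%E.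
Proof.
move=> XN indep.
under eq_integral do rewrite expR_sum.
rewrite (@integral_prod_independent _ _ _ _ _ X (fun i x => expR (c i * x)) indep).
- rewrite expR_sum -prodEFin; apply: eq_bigr => i _.
  exact: (integral_expR_normal _ (XN i)).
- by move=> i; apply: measurableT_comp => //; exact: measurable_funM.
- by move=> i x; exact: expR_ge0.
- by move=> i; rewrite (integral_expR_normal _ (XN i)).
Qed.

(** * Shattered sets and the Sauer-Shelah bound *)

Section Shattering.
Import mathcomp.boot.finset.
Local Close Scope classical_set_scope.

Definition shatters (T : finType) (F : {set {set T}}) (S : {set T}) : bool :=
  [forall A : {set T}, (A \subset S) ==> [exists B in F, B :&: S == A]].

Lemma shattersP (T : finType) (F : {set {set T}}) (S : {set T}) :
  reflect (forall A : {set T}, A \subset S -> exists2 B, B \in F & B :&: S = A)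
          (shatters F S).
Proof.
apply: (iffP forallP) => H A.
  by move=> AS; have /implyP/(_ AS)/exists_inP[B BF /eqP] := H A; exists B.
apply/implyP => /H [B BF BA]; apply/exists_inP; exists B => //; exact/eqP.
Qed.

(** Strong induction on [#|F|]: a point [x] on which two members differ splits [F] into two smaller
    nonempty families [F0] and [F1]. Sets shattered by either are shattered by [F]; a set shattered
    by both is counted twice, and adding [x] to it supplies the second set. *)
Lemma card_shattered (T : finType) (F : {set {set T}}) :
  (#|F| <= #|[set S | shatters F S]|)%N.
Proof.
have [k] := ubnP #|F|; elim: k F => // k IH F; rewrite ltnS => Fk.
have [F1|] := leqP #|F| 1.
  have [->|[A AF]] := set_0Vmem F; first by rewrite cards0.
  apply: (leq_trans F1); apply/card_gt0P; exists set0; rewrite inE.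
  apply/shattersP => B; rewrite subset0 => /eqP ->.
  by exists A => //; rewrite setI0.
case/card_gt1P => [A [B [AF BF AB]]].
have [x xAB] : exists x, (x \in A) != (x \in B).
  apply/existsP; apply: contraR AB; rewrite negb_exists => /forallP AB.
  by apply/eqP/setP => x; apply/eqP; rewrite -[_ == _]negbK AB.
pose F1 := F :&: [set C : {set T} | x \in C]; pose F0 := F :\: [set C : {set T} | x \in C].
have cF : (#|F0| + #|F1| = #|F|)%N by rewrite addnC cardsID.
have F0_gt0 : (0 < #|F0|)%N.
  apply/card_gt0P; move: xAB.
  case: (boolP (x \in A)) => xA; case: (boolP (x \in B)) => xB // _.
    by exists B; rewrite !inE BF xB.
  by exists A; rewrite !inE AF xA.
have F1_gt0 : (0 < #|F1|)%N.
  apply/card_gt0P; move: xAB.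
  case: (boolP (x \in A)) => xA; case: (boolP (x \in B)) => xB // _.
    by exists A; rewrite !inE AF xA.
  by exists B; rewrite !inE BF xB.
have x0 S : shatters F0 S -> x \notin S.
  move=> /shattersP/(_ S (subxx _))[C]; rewrite !inE => /andP[xC _] CS.
  by rewrite -CS inE (negbTE xC).
have x1 S : shatters F1 S -> x \notin S.
  move=> /shattersP/(_ set0 (sub0set _))[C]; rewrite !inE => /andP[_ xC] CS.
  by apply/negP => xS; move/setP/(_ x): CS; rewrite !inE xC xS.
pose s0 := [set S | shatters F0 S]; pose s1 := [set S | shatters F1 S].
(* No set in [s0] or [s1] contains [x], so [s2] is disjoint from both and has as many elements as
   [s0 :&: s1]; inclusion-exclusion then adds up exactly. *)
pose s2 := [set x |: S | S in s0 :&: s1].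
have c2 : #|s2| = #|s0 :&: s1|.
  apply: card_in_imset => S S'; rewrite !inE => /andP[/x0 xS _] /andP[/x0 xS' _].
  by move=> /(congr1 (fun C => C :\ x)); rewrite !setU1K.
have dis : [disjoint s0 :|: s1 & s2].
  rewrite disjoint_sym disjoints_subset; apply/fintype.subsetP => S /imsetP[S' _ ->].
  rewrite !inE; apply/negP => /orP[/x0|/x1]; by rewrite setU11.
have sub : (s0 :|: s1) :|: s2 \subset [set S | shatters F S].
  apply/fintype.subsetP => S; rewrite !inE => /orP[/orP[]/shattersP H|/imsetP[S' + ->]].
  - by apply/shattersP => C /H[D]; rewrite !inE => /andP[_ DF] DS; exists D.
  - by apply/shattersP => C /H[D]; rewrite !inE => /andP[DF _] DS; exists D.
  rewrite !inE => /andP[/[dup]/x0 xS' /shattersP H0 /shattersP H1].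
  apply/shattersP => C CS.
  have CS' : C :\ x \subset S' by rewrite subDset.
  have [xC|xC] := boolP (x \in C).
    have [D] := H1 _ CS'; rewrite !inE => /andP[DF xD] DS.
    exists D => //; rewrite setIUr DS -[RHS](setD1K xC); congr (_ :|: _).
    by apply/setIidPr; rewrite sub1set.
  have [D] := H0 _ CS'; rewrite !inE => /andP[xD DF] DS.
  exists D => //; rewrite setIUr DS (_ : D :&: [set x] = set0) ?set0U.
    by apply/setP => y; rewrite !inE; case: eqVneq => // ->; rewrite (negbTE xC).
  by apply/setP => y; rewrite !inE andbC; case: eqVneq => // ->; rewrite (negbTE xD).
apply: leq_trans (subset_leq_card sub).
rewrite cardsU (disjoint_setI0 dis) cards0 subn0 c2 cardsUI -cF leq_add//.
  by apply: IH; apply: leq_trans Fk; rewrite -cF -addn1 leq_add2l.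
by apply: IH; apply: leq_trans Fk; rewrite -cF -add1n leq_add2r.
Qed.

(** Such a set is the set of values of a partial map from ['I_k] to [T]: list its elements and pad
    with [None]. *)
Lemma card_small_sets (T : finType) (k : nat) :
  (#|[set S : {set T} | #|S| <= k]| <= #|T|.+1 ^ k)%N.
Proof.
pose h (f : {ffun 'I_k -> option T}) := [set x | [exists i, f i == Some x]].
have -> : (#|T|.+1 ^ k = #|{ffun 'I_k -> option T}|)%N.
  by rewrite card_ffun card_option card_ord.
rewrite -cardsT; apply: leq_trans (leq_imset_card h _).
apply/subset_leq_card/fintype.subsetP => S; rewrite inE => Sk.
apply/imsetP; exists [ffun i : 'I_k => onth (enum S) i] => //.
apply/setP => x; rewrite inE; apply/idP/existsP => [xS|[i]].
  have iS : (index x (enum S) < #|S|)%N by rewrite cardE index_mem mem_enum.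
  exists (Ordinal (leq_trans iS Sk)); rewrite ffunE onthE /= (nth_map x) -?cardE//.
  by rewrite nth_index ?mem_enum.
rewrite ffunE -mem_enum => /eqP iE.
by apply/onthP; exists i.
Qed.

Lemma sauer_shelah (T : finType) (F : {set {set T}}) (k : nat) :
  (forall S, shatters F S -> #|S| <= k)%N -> (#|F| <= #|T|.+1 ^ k)%N.
Proof.
move=> Fk; apply: leq_trans (card_shattered F) _.
apply: leq_trans (card_small_sets T k); apply/subset_leq_card/fintype.subsetP => S.
by rewrite !inE; exact: Fk.
Qed.

End Shattering.

(** * Counting the traces of half-spaces on the design points *)

Section Halfspaces.
Import mathcomp.boot.finset.
Local Close Scope classical_set_scope.
Context {R : realType} {d n : nat}.
Implicit Types x : 'I_n -> 'rV[R]_d.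

Definition halfspace_traces x : {set {set 'I_n}} :=
  [set S : {set 'I_n} |
    `[< exists a b, forall i, (i \in S) = (0 < inner a (x i) + b) >]].

(* Radon's argument: the vectors (x i, 1), i in S, are linearly dependent as
   soon as #|S| > d.+1, and no half-space can cut out exactly the indices with
   positive coefficient in a dependency. *)
Lemma card_shattered_halfspaces x (S : {set 'I_n}) :
  shatters (halfspace_traces x) S -> (#|S| <= d.+1)%N.
Proof.
move=> /shattersP shS; rewrite leqNgt; apply/negP => dS.
pose e (j : 'I_#|S|) : 'I_n := enum_val j.
pose M := row_mx (\matrix_(j < #|S|, t < d) x (e j) 0 t)
                 (const_mx 1 : 'M[R]_(#|S|, 1)).
(* [M] has more than [d.+1] rows but only [d + 1] columns, so its rows satisfy a nontrivial linear
   relation [c]. *)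
have [c /sub_kermxP cM c0] : exists2 c : 'rV_#|S|, (c <= kermx M)%MS & c != 0.
  apply/rowV0Pn; rewrite -mxrank_eq0 mxrank_ker subn_eq0 -ltnNge.
  by apply: (leq_ltn_trans (rank_leq_col M)); rewrite addn1.
move: cM; rewrite mul_mx_row -row_mx0 => /eq_row_mx[cx c1].
have sumc : \sum_j c 0 j = 0.
  move/matrixP/(_ 0 0): c1; rewrite !mxE => cE; rewrite -[RHS]cE.
  by apply: eq_bigr => j _; rewrite !mxE mulr1.
have sumcx t : \sum_j c 0 j * x (e j) 0 t = 0.
  move/matrixP/(_ 0 t): cx; rewrite !mxE => cE; rewrite -[RHS]cE.
  by apply: eq_bigr => j _; rewrite !mxE.
have [j0 cj0] : exists j, 0 < c 0 j.
  apply/existsP; apply: contraR c0; rewrite negb_exists => /forallP cle.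
  have cle0 j : 0 <= - c 0 j by rewrite oppr_ge0 leNgt.
  have /eqP : \sum_j - c 0 j = 0 by rewrite sumrN sumc oppr0.
  rewrite psumr_eq0// => /allP cE; apply/eqP/rowP => j.
  by rewrite mxE; apply/eqP; rewrite -oppr_eq0; apply: cE; rewrite mem_index_enum.
have [|B] := shS [set e j | j in [pred j | 0 < c 0 j]].
  by apply/fintype.subsetP => i /imsetP[j _ ->]; exact: enum_valP.
rewrite inE => /asboolP[a [b BE]] BS.
have posE j : (0 < inner a (x (e j)) + b) = (0 < c 0 j).
  rewrite -BE; move/setP/(_ (e j)): BS; rewrite inE enum_valP andbT => ->.
  apply/imsetP/idP => [[j' + /enum_val_inj ->]//|cj].
  by exists j.
have sum0 : \sum_j c 0 j * (inner a (x (e j)) + b) = 0.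
  under eq_bigr do rewrite mulrDr.
  rewrite big_split /= -mulr_suml sumc mul0r addr0.
  under eq_bigr do rewrite /inner mulr_sumr.
  rewrite exchange_big big1// => t _.
  under eq_bigr do rewrite mulrCA.
  by rewrite -mulr_sumr sumcx mulr0.
(* The affine form has the sign pattern of [c], so no term of the vanishing sum is negative, while
   the term at [j0] is positive: a contradiction. *)
have ge0 j : 0 <= c 0 j * (inner a (x (e j)) + b).
  have [cj|cj] := ltP 0 (c 0 j); first by rewrite mulr_ge0 ?ltW ?posE.
  by rewrite mulr_le0// leNgt posE -leNgt.
move/eqP: sum0; rewrite psumr_eq0// => /allP/(_ j0 (mem_index_enum _)) /=.
by rewrite gt_eqF// mulr_gt0// posE.
Qed.

Lemma card_halfspace_traces x : (#|halfspace_traces x| <= n.+1 ^ d.+1)%N.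
Proof.
by have := sauer_shelah (@card_shattered_halfspaces x); rewrite card_ord.
Qed.

End Halfspaces.

Lemma halfspace_trace_phi (R : realType) (d n : nat) (x : 'I_n -> 'rV[R]_d) a b :
  exists2 S, S \in halfspace_traces x & forall i, phi x a b i = (i \in S)%:R.
Proof.
exists (finset.finset (fun i => 0 < inner a (x i) + b)).
  by rewrite finset.inE; apply/asboolP; exists a, b => i; rewrite finset.inE.
by move=> i; rewrite /phi finset.inE; case: ifP.
Qed.

(** * Deterministic inequalities for the penalized criterion *)

Section Lasso.
Context {R : realType} {d n : nat}.
Implicit Types (x : 'I_n -> 'rV[R]_d) (h g f e v : 'I_n -> R) (lam : R).

Lemma L1norm_ge0 x h : 0 <= L1norm x h.
Proof.
rewrite /L1norm; set E := [set t | _].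
(* Outside the span there is no representation, and the infimum of the empty set is 0 by
   convention. *)
have [->|/set0P E0] := eqVneq E set0; first by rewrite inf0.
apply: lb_le_inf => // _ [k [a [b [th [_ ->]]]]].
by apply: sumr_ge0 => j _; exact: normr_ge0.
Qed.

Lemma sqn_ge0 v : 0 <= sqn v.
Proof. by rewrite mulr_ge0 ?invr_ge0// sumr_ge0// => i _; exact: sqr_ge0. Qed.

Lemma in_L1_0 x : in_L1 x (fun=> 0).
Proof.
exists 0%N, (fun=> 0), (fun=> 0), (fun=> 0) => i.
by rewrite big_ord0.
Qed.

(** Each representation of [h] bounds the pairing by [M] times the sum of its absolute coefficients.
    Dividing by [M] turns this into a lower bound of the set whose infimum is [L1norm x h];
    membership in the span makes that set nonempty. *)
Lemma pairing_le_L1norm x v h (M : R) : 0 < M ->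
  (forall a b, `|\sum_(i < n) v i * phi x a b i| <= M) -> in_L1 x h ->
  `|\sum_(i < n) v i * h i| <= M * L1norm x h.
Proof.
move=> M0 vM hL1; rewrite -ler_pdivrMl//; apply: lb_le_inf.
  by case: hL1 => k [a [b [th rh]]]; exists (\sum_(j < k) `|th j|), k, a, b, th.
move=> _ [k [a [b [th [rh ->]]]]]; rewrite ler_pdivrMl//.
under eq_bigr do rewrite rh mulr_sumr.
rewrite exchange_big /= mulr_sumr; apply: le_trans (ler_norm_sum _ _ _) _.
apply: ler_sum => j _; under eq_bigr do rewrite mulrCA.
by rewrite -mulr_sumr normrM mulrC ler_wpM2r.
Qed.

Lemma sqnD f e g : sqn (fun i => f i + e i - g i) =
  sqn (fun i => f i - g i) + 2 * (n%:R^-1 * \sum_i e i * (f i - g i)) + sqn e.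
Proof.
rewrite /sqn mulrCA -!mulrDr; congr (_ * _).
rewrite mulr_sumr -!big_split /=; apply: eq_bigr => i _; ring.
Qed.

(** Once both squares are expanded by [sqnD], the term [sqn e] is common to the two sides and
    cancels. *)
Lemma objective_le_noise x lam f e g h :
  objective x lam (fun i => f i + e i) g <= objective x lam (fun i => f i + e i) h ->
  sqn (fun i => f i - g i) + lam * L1norm x g <=
  objective x lam f h + 2 * (n%:R^-1 * \sum_i e i * (g i - h i)).
Proof.
rewrite /objective !sqnD.
have -> : \sum_i e i * (g i - h i) =
    \sum_i e i * (f i - h i) - \sum_i e i * (f i - g i).
  by rewrite -sumrB; apply: eq_bigr => i _; ring.
set A := \sum_i e i * (f i - h i); set B := \sum_i e i * (f i - g i).
rewrite [n%:R^-1 * (A - B)]mulrBr; lra.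
Qed.

(** Twice the pairing costs at most [lam / 2] times each of the two norms. Half of the penalty of
    [g] absorbs its share, and doubling gives factors 2 on the squared error of [h] and 3 on its
    penalty. *)
Lemma loss_le_small_noise x lam f e g h : 0 < lam -> (0 < n)%N ->
  (forall a b, `|\sum_(i < n) e i * phi x a b i| <= n%:R * lam / 4) ->
  in_L1 x g -> in_L1 x h ->
  objective x lam (fun i => f i + e i) g <= objective x lam (fun i => f i + e i) h ->
  sqn (fun i => f i - g i) + lam * L1norm x g <= 3 * objective x lam f h.
Proof.
move=> lam0 n0 eM gL hL /objective_le_noise.
have nR0 : 0 < n%:R :> R by rewrite ltr0n.
have M0 : 0 < n%:R * lam / 4 by rewrite divr_gt0 ?mulr_gt0.
have eg := pairing_le_L1norm M0 eM gL.
have eh := pairing_le_L1norm M0 eM hL.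
have -> : \sum_i e i * (g i - h i) = \sum_i e i * g i - \sum_i e i * h i.
  by rewrite -sumrB; apply: eq_bigr => i _; ring.
have : n%:R^-1 * (\sum_i e i * g i - \sum_i e i * h i) <=
    lam / 4 * (L1norm x g + L1norm x h).
  rewrite ler_pdivrMl//; apply: le_trans (ler_norm _) _.
  apply: le_trans (ler_normB _ _) _; apply: le_trans (lerD eg eh) _.
  by rewrite -mulrDr !mulrA.
have := sqn_ge0 (fun i => f i - g i); have := sqn_ge0 (fun i => f i - h i).
have := mulr_ge0 (ltW lam0) (L1norm_ge0 x g).
have := mulr_ge0 (ltW lam0) (L1norm_ge0 x h).
rewrite /objective; lra.
Qed.

(** Young's inequality, with [g - h] split through [f]: half of the squared error of [g] is absorbed
    on the left, and doubling turns [4 * sqn e] into [8 * sqn e]. *)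
Lemma loss_le_any_noise x lam f e g h : 0 <= lam ->
  objective x lam (fun i => f i + e i) g <= objective x lam (fun i => f i + e i) h ->
  sqn (fun i => f i - g i) + lam * L1norm x g <=
  3 * objective x lam f h + 8 * sqn e.
Proof.
move=> lam0 /objective_le_noise.
have : 2 * (n%:R^-1 * \sum_i e i * (g i - h i)) <=
    2^-1 * sqn (fun i => f i - g i) + 2^-1 * sqn (fun i => f i - h i) + 4 * sqn e.
  rewrite /sqn !(mulrCA _ n%:R^-1) -!mulrDr ler_wpM2l ?invr_ge0//.
  rewrite !mulr_sumr -!big_split /= mulr_sumr -big_split /=; apply: ler_sum => i _.
  have := sqr_ge0 (f i - g i + 2 * e i); have := sqr_ge0 (f i - h i - 2 * e i).
  lra.
have := mulr_ge0 lam0 (L1norm_ge0 x g).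
have := mulr_ge0 lam0 (L1norm_ge0 x h).
rewrite /objective; lra.
Qed.

End Lasso.

(** * Exponential domination of the noise on the exceptional event *)

Section ExponentialBound.
Context {R : realType} {n : nat}.

Lemma sqr_le_expR (z : R) : z ^+ 2 <= 2 * (expR z + expR (- z)).
Proof.
have key (y : R) : 0 <= y -> y ^+ 2 <= 2 * (expR y + expR (- y)).
  move=> y0; have := expR_ge1Dxn 1 y0; have := expR_ge0 (- y).
  rewrite (_ : 2`!%:R = 2)//; lra.
have [z0|z0] := leP 0 z; first exact: key.
by have := key (- z); rewrite sqrrN opprK addrC; apply; rewrite oppr_ge0 ltW.
Qed.

(** The first pair picks an exponential dominating a squared noise coordinate, the second one
    dominating the indicator of a large sum over a trace; an index stands for their product. *)
Definition tilt_index (F : {set {set 'I_n}}) :=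
  finset.setX (finset.setTfor ('I_n * bool)%type) (finset.setX F (finset.setTfor bool)).

(* For p = ((i, s), (S, s')), tilt u p is the coefficient vector of the linear
   form  +-e_i +- u * \sum_(j in S) e_j  with signs given by s and s'. *)
Definition tilt (u : R) (p : ('I_n * bool) * ({set 'I_n} * bool)) (j : 'I_n) : R :=
  (-1) ^+ p.1.2 * (j == p.1.1)%:R + (-1) ^+ p.2.2 * u * (j \in p.2.1)%:R.

Lemma sum_tilt (u : R) i s S s' (e : 'I_n -> R) :
  \sum_j tilt u ((i, s), (S, s')) j * e j =
  (-1) ^+ s * e i + (-1) ^+ s' * u * \sum_(j in S) e j.
Proof.
rewrite /tilt /=; under eq_bigr do rewrite mulrDl.
rewrite big_split /=; congr (_ + _).
  rewrite (bigD1 i)//= eqxx mulr1 big1 ?addr0// => j /negbTE ->.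
  by rewrite mulr0 mul0r.
rewrite [in RHS]big_mkcond mulr_sumr; apply: eq_bigr => j _.
by case: ifP => _; rewrite /= ?mulr1n ?mulr0n ?mulr1 ?mulr0 ?mul0r.
Qed.

Lemma sum_sqr_tilt (u : R) p : 0 <= u ->
  \sum_j tilt u p j ^+ 2 / 2 <= (1 + 2 * u + u ^+ 2 * n%:R) / 2.
Proof.
move=> u0; rewrite -mulr_suml ler_pM2r//.
(* Every coordinate contributes at most [u ^+ 2]; the distinguished one is at most [(1 + u) ^+ 2],
   hence the extra [1 + 2 * u]. *)
have -> : 1 + 2 * u + u ^+ 2 * n%:R =
    \sum_(j < n) ((1 + 2 * u) * (j == p.1.1)%:R + u ^+ 2).
  rewrite big_split /= sumr_const card_ord mulr_natr; congr (_ + _).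
  by rewrite (bigD1 p.1.1)//= eqxx mulr1 big1 ?addr0// => j /negbTE ->; rewrite mulr0.
apply: ler_sum => j _; rewrite /tilt; have := sqr_ge0 u.
case: (_ == _); case: (_ \in _); case: p.1.2; case: p.2.2;
  rewrite /= ?expr0 ?expr1; lra.
Qed.

Lemma sum_sqr_le_tilt (F : {set {set 'I_n}}) (e : 'I_n -> R) (u t : R) S :
  0 <= u -> S \in F -> t < `|\sum_(j in S) e j| ->
  \sum_i e i ^+ 2 <= 2 * expR (- (u * t)) *
    \sum_(p in tilt_index F) expR (\sum_j tilt u p j * e j).
Proof.
move=> u0 SF tS.
pose E (q : 'I_n * bool) := expR ((-1) ^+ q.2 * e q.1).
pose H (q : {set 'I_n} * bool) := expR ((-1) ^+ q.2 * u * \sum_(j in q.1) e j).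
have -> : \sum_(p in tilt_index F) expR (\sum_j tilt u p j * e j) =
    (\sum_q E q) * \sum_(q | q.1 \in F) H q.
  rewrite big_distrlr pair_big /=; apply: eq_big => [[q [S' s']]|[[i s] [S' s']] _].
    by rewrite !finset.inE andbT.
  by rewrite sum_tilt expRD.
have eE : \sum_i e i ^+ 2 <= 2 * \sum_q E q.
  rewrite -(pair_bigA _ (fun i s => E (i, s))) mulr_sumr; apply: ler_sum => i _.
  apply: le_trans (sqr_le_expR _) _.
  by rewrite big_bool /E /= expr1 expr0 mulN1r mul1r addrC.
have uH : expR (u * t) <= \sum_(q | q.1 \in F) H q.
  (* The sign [s] makes the signed sum over [S] equal to its absolute value. *)
  pose s := \sum_(j in S) e j < 0.
  rewrite (bigD1 (S, s))//=; apply: ler_wpDr.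
    by apply: sumr_ge0 => q _; exact: expR_ge0.
  rewrite /H /= ler_expR [_ ^+ s * u]mulrC -mulrA; apply: ler_wpM2l => //.
  by apply: ltW; apply: (lt_le_trans tS); rewrite normrEsign.
apply: (le_trans eE).
have -> : 2 * (\sum_q E q) = 2 * expR (- (u * t)) * ((\sum_q E q) * expR (u * t)).
  by rewrite expRN; field; rewrite gt_eqF ?expR_gt0.
apply: ler_wpM2l; first by rewrite mulr_ge0// expR_ge0.
by apply: ler_wpM2l => //; apply: sumr_ge0 => q _; exact: expR_ge0.
Qed.

Lemma card_tilt_index (F : {set {set 'I_n}}) :
  #|tilt_index F| = (4 * n * #|F|)%N.
Proof.
by rewrite !finset.cardsX !finset.cardsT card_prod card_ord card_bool; lia.
Qed.

(* This u minimizes u ^+ 2 * n / 2 - u * t up to a constant factor: the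
   exponent is at most - 5 (L + 4) ^ 2, which absorbs n * #|F|. *)
Lemma tilted_sum_le (F : {set {set 'I_n}}) (L u t : R) : (0 < n)%N -> 0 <= L ->
  #|F|%:R <= expR (L ^+ 2) -> n%:R <= expR (L ^+ 2) ->
  u = (L + 4) / Num.sqrt n%:R -> t = 7 * Num.sqrt n%:R * (L + 4) ->
  expR (- (u * t)) *
    \sum_(p in tilt_index F) expR (\sum_j tilt u p j ^+ 2 / 2) <= 4.
Proof.
move=> n0 L0 FL nL uE tE.
have sn0 : 0 < Num.sqrt n%:R :> R by rewrite sqrtr_gt0 ltr0n.
have sn1 : 1 <= Num.sqrt n%:R :> R by rewrite -[leLHS]sqrtr1 ler_sqrt ?ltr0n// ler1n.
have snn : Num.sqrt n%:R ^+ 2 = n%:R :> R by rewrite sqr_sqrtr.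
have u0 : 0 <= u by rewrite uE divr_ge0// ?addr_ge0// ltW.
have uL : u <= L + 4 by rewrite uE ler_pdivrMr// ler_peMr// addr_ge0.
have u2 : u ^+ 2 * n%:R = (L + 4) ^+ 2.
  by rewrite uE -[X in _ * X]snn -exprMn divfK// gt_eqF.
have ut : u * t = 7 * (L + 4) ^+ 2.
  by rewrite uE tE; field; rewrite gt_eqF.
apply: (@le_trans _ _ (expR (- (u * t)) *
    (4 * (n%:R * #|F|%:R) * expR ((1 + 2 * u + u ^+ 2 * n%:R) / 2)))).
  rewrite ler_wpM2l ?expR_ge0//.
  pose M : R := expR ((1 + 2 * u + u ^+ 2 * n%:R) / 2).
  apply: (@le_trans _ _ (\sum_(p in tilt_index F) M)).
    by apply: ler_sum => p _; rewrite ler_expR; exact: sum_sqr_tilt.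
  by rewrite -/M sumr_const card_tilt_index -[leLHS]mulr_natl !natrM -!mulrA.
rewrite -mulrA mulrCA -[leRHS]mulr1 ler_pM2l// mulrCA -expRD.
apply: (@le_trans _ _ (expR (L ^+ 2) * expR (L ^+ 2) *
    expR (- (u * t) + (1 + 2 * u + u ^+ 2 * n%:R) / 2))).
  by rewrite ler_wpM2r ?expR_ge0// ler_pM.
(* As [u] is at most [L + 4], what remains is that 2 L^2 - 7 (L + 4)^2 + (1 + 2 (L + 4) + (L + 4)^2)
   / 2 is nonpositive. *)
rewrite -!expRD -[leRHS]expR0 ler_expR u2 ut; nra.
Qed.

End ExponentialBound.

(** * From pointwise bounds to the expected loss *)

Lemma le_integral_tilted_exp (R : realType) (dT : measure_display)
    (T : measurableType dT) (P : probability T R) (n : nat)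
    (xi : 'I_n -> {RV P >-> R}) (I : finType) (A : {set I})
    (c : I -> 'I_n -> R) (loss : T -> R) (a k b : R) :
  (forall i (B : set R), measurable B ->
     P (xi i @^-1` B) = normal_prob 0 1 B) ->
  (forall B : 'I_n -> set R, (forall i, measurable (B i)) ->
     P (\bigcap_(i in [set: 'I_n]) (xi i @^-1` B i)) =
     (\prod_(i < n) P (xi i @^-1` B i))%E) ->
  measurable_fun setT loss -> (forall w, 0 <= loss w) -> 0 <= a -> 0 <= k ->
  (forall w, loss w <= a + k * \sum_(p in A) expR (\sum_j c p j * xi j w)) ->
  k * \sum_(p in A) expR (\sum_j c p j ^+ 2 / 2) <= b ->
  (\int[P]_w (loss w)%:E <= (a + b)%:E)%E.
Proof.
move=> xiN indep mloss loss0 a0 k0 loss_le kb.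
have mE p : measurable_fun setT (fun w => (expR (\sum_j c p j * xi j w))%:E).
  apply/measurable_EFinP; apply: measurableT_comp => //.
  apply: measurable_sum => j; exact: measurable_funM.
pose s := enum A.
have -> : (a + b)%:E = (\int[P]_w a%:E + b%:E)%E.
  by rewrite integral_cst// [X in (_ * X)%E]probability_setT mule1.
apply: (@le_trans _ _ (\int[P]_w (a%:E + k%:E *
    \sum_(p <- s) (expR (\sum_j c p j * xi j w))%:E))%E).
  apply: ge0_le_integral => //.
  - by move=> w _; rewrite lee_fin.
  - exact/measurable_EFinP.
  - apply: emeasurable_funD => //; apply: measurable_funeM.
    exact: emeasurable_sum.
  - by move=> w _; rewrite sumEFin -EFinM -EFinD lee_fin big_enum.
have sum0 w : (0 <= \sum_(p <- s) (expR (\sum_j c p j * xi j w))%:E)%E.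
  by apply: sume_ge0 => p _; rewrite lee_fin expR_ge0.
rewrite ge0_integralD//; last 2 first.
- by move=> w _; rewrite mule_ge0.
- by apply: measurable_funeM; exact: emeasurable_sum.
rewrite leeD2l// ge0_integralZl_EFin//; last exact: emeasurable_sum.
rewrite ge0_integral_sum//.
under eq_bigr do rewrite (integral_expR_sum_normal _ xiN indep).
by rewrite sumEFin -EFinM lee_fin big_enum.
Qed.

Theorem theorem6p1 (R : realType) :
  exists C : R, 0 < C /\
  forall (d n : nat) (x : 'I_n -> 'rV[R]_d) (f : 'rV[R]_d -> R) (sigma lam : R)
    (dT : measure_display) (T : measurableType dT) (P : probability T R)
    (xi : 'I_n -> {RV P >-> R})
    (fhat : ('I_n -> R) -> ('I_n -> R)),
  (0 < d)%N -> (0 < n)%N -> 0 < sigma ->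
  (* xi_i ~ N(0,1) *)
  (forall i (B : set R), measurable B ->
     P (xi i @^-1` B) = normal_prob 0 1 B) ->
  (* mutual independence of xi_1..xi_n *)
  (forall B : 'I_n -> set R, (forall i, measurable (B i)) ->
     P (\bigcap_(i in [set: 'I_n]) (xi i @^-1` B i)) =
     (\prod_(i < n) P (xi i @^-1` B i))%E) ->
  lam >= 28 * sigma / Num.sqrt n%:R *
           (Num.sqrt (ln (n.+1%:R ^+ d.+1)) + 4) ->
  (* fhat(Y) is a minimizer of the penalized criterion over L_1(D) *)
  (forall y : 'I_n -> R, in_L1 x (fhat y) /\
     forall h, in_L1 x h -> objective x lam y (fhat y) <= objective x lam y h) ->
  let Y := fun (w : T) (i : 'I_n) => f (x i) + sigma * xi i w in
  let loss := fun w : T =>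
      sqn (fun i => f (x i) - fhat (Y w) i) + lam * L1norm x (fhat (Y w)) in
  measurable_fun setT loss ->
  (\int[P]_w (loss w)%:E <=
   (C * (inf [set objective x lam (fun i => f (x i)) h | h in in_L1 x]
         + lam * (sigma / Num.sqrt n%:R)))%:E)%E.
Proof.
exists 3; split=> // d n x f sigma lam dT T P xi fhat d0 n0 sigma0 xiN indep
  lam_ge fhatP Y loss mloss.
set L := Num.sqrt (ln _) in lam_ge.
pose u := (L + 4) / Num.sqrt n%:R; pose t := 7 * Num.sqrt n%:R * (L + 4).
pose F := halfspace_traces x.
have nR0 : 0 < n%:R :> R by rewrite ltr0n.
have sn0 : 0 < Num.sqrt n%:R :> R by rewrite sqrtr_gt0.
have snn : n%:R = Num.sqrt n%:R * Num.sqrt n%:R :> R.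
  by rewrite -expr2 sqr_sqrtr// ltW.
have L0 : 0 <= L by exact: sqrtr_ge0.
have L40 : 0 < L + 4 by rewrite ltr_wpDl.
have lam0 : 0 < lam.
  by apply: lt_le_trans lam_ge; rewrite mulr_gt0// divr_gt0// mulr_gt0.
have u0 : 0 <= u by rewrite divr_ge0 ?ltW.
have N1 : 1 <= n.+1%:R ^+ d.+1 :> R by rewrite exprn_ege1// ler1n.
(* This turns the logarithm in the assumption on [lam] into the bound on the number of half-space
   traces, which also dominates [n]. *)
have expL : expR (L ^+ 2) = n.+1%:R ^+ d.+1.
  rewrite sqr_sqrtr ?ln_ge0// lnK//.
  by rewrite posrE (lt_le_trans ltr01).
have FL : #|F|%:R <= expR (L ^+ 2).
  by rewrite expL -natrX ler_nat card_halfspace_traces.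
have nL : n%:R <= expR (L ^+ 2).
  rewrite expL -natrX ler_nat (leq_trans (leqnSn n))//.
  by rewrite -[leqLHS]expn1 leq_exp2l.
(* Here 28 = 4 * 7: the threshold [t] carries the 7, and the small-noise bound asks for a quarter of
   [lam]. *)
have st : sigma * t <= n%:R * lam / 4.
  rewrite /t [in leRHS]snn.
  have : 28 * sigma * (L + 4) <= lam * Num.sqrt n%:R.
    by rewrite -ler_pdivrMr//; apply: le_trans lam_ge; rewrite mulrAC.
  move/(ler_wpM2r (ltW sn0)); lra.
(* The 16 is the 8 of [loss_le_any_noise] times the 2 of [sum_sqr_le_tilt]; [sigma ^+ 2 / n%:R]
   comes from [sqn] of the scaled noise. *)
pose k := 16 * sigma ^+ 2 / n%:R * expR (- (u * t)).
have k0 : 0 <= k by rewrite mulr_ge0 ?expR_ge0// divr_ge0 ?mulr_ge0 ?sqr_ge0// ltW.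
pose fx i := f (x i).
have obj0 h : 0 <= objective x lam fx h.
  by rewrite addr_ge0 ?sqn_ge0// mulr_ge0 ?L1norm_ge0// ltW.
have loss_le h w : in_L1 x h -> loss w <= 3 * objective x lam fx h +
    k * \sum_(p in tilt_index F) expR (\sum_j tilt u p j * xi j w).
  move=> hL; have [gL gopt] := fhatP (Y w).
  (* Either some trace has a large noise sum, and the crude bound is paid for by the exponentials,
     or all traces are below [t] and the small-noise bound applies. *)
  have [[S SF tS]|small] :=
      pselect (exists2 S, S \in F & t < `|\sum_(j in S) xi j w|).
    apply: le_trans (loss_le_any_noise (ltW lam0) (gopt h hL)) _.
    rewrite lerD2l//.
    have := sum_sqr_le_tilt u0 SF tS; set Q := \sum_(p in _) _ => xiQ.
    have -> : sqn (fun i => sigma * xi i w) =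
        sigma ^+ 2 / n%:R * \sum_i xi i w ^+ 2.
      rewrite /sqn mulrC [RHS]mulrAC; congr (_ * _); rewrite mulr_sumr.
      by apply: eq_bigr => i _; rewrite exprMn.
    have : 0 <= sigma ^+ 2 / n%:R by rewrite divr_ge0 ?sqr_ge0// ltW.
    move/ler_wpM2l => /(_ _ _ xiQ); rewrite /k; lra.
  have lossg : loss w <= 3 * objective x lam fx h.
    apply: (loss_le_small_noise lam0 n0 _ gL hL (gopt h hL)) => a b.
    have [S SF phiS] := halfspace_trace_phi x a b.
    under eq_bigr do rewrite phiS -mulrA.
    rewrite -mulr_sumr normrM gtr0_norm//; apply: le_trans st.
    rewrite ler_pM2l// (eq_bigr (fun j => if j \in S then xi j w else 0)).
      rewrite -big_mkcond leNgt; apply/negP => tS; apply: small; exists S => //.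
    by move=> j _; case: ifP => _; rewrite ?mulr1 ?mulr0.
  apply: le_trans lossg _; rewrite lerDl mulr_ge0//.
  by apply: sumr_ge0 => p _; exact: expR_ge0.
have tail : k * \sum_(p in tilt_index F) expR (\sum_j tilt u p j ^+ 2 / 2) <=
    3 * (lam * (sigma / Num.sqrt n%:R)).
  have := tilted_sum_le n0 L0 FL nL erefl erefl; rewrite -/u -/t => tail4.
  rewrite /k -mulrA.
  apply: (@le_trans _ _ (16 * sigma ^+ 2 / n%:R * 4)).
    by rewrite ler_wpM2l// divr_ge0 ?mulr_ge0 ?sqr_ge0// ltW.
  (* Only the summand 4 in the assumption is kept, 112 = 28 * 4; this is ample to absorb the 64 = 16
     * 4 left by the tail. *)
  have lam4 : 112 * sigma / Num.sqrt n%:R <= lam.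
    apply: le_trans lam_ge.
    have : 0 <= sigma / Num.sqrt n%:R * L by rewrite mulr_ge0 ?divr_ge0// ltW.
    lra.
  have ss0 : 0 <= sigma / Num.sqrt n%:R by rewrite divr_ge0// ltW.
  have -> : 16 * sigma ^+ 2 / n%:R * 4 = 64 * ((sigma / Num.sqrt n%:R) ^+ 2).
    by rewrite [in LHS]snn; field; rewrite gt_eqF.
  have := ler_wpM2r ss0 lam4; have := sqr_ge0 (sigma / Num.sqrt n%:R).
  lra.
have loss0 w : 0 <= loss w.
  by rewrite addr_ge0 ?sqn_ge0// mulr_ge0 ?L1norm_ge0// ltW.
have bound h : in_L1 x h -> (\int[P]_w (loss w)%:E <=
    (3 * objective x lam fx h + 3 * (lam * (sigma / Num.sqrt n%:R)))%:E)%E.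
  move=> hL; apply: (le_integral_tilted_exp xiN indep mloss loss0 _ k0 _ tail).
    by rewrite mulr_ge0.
  by move=> w; exact: loss_le.
(* The zero competitor shows that the expectation is finite, so it can be compared as a real number
   with the infimum over [h]. *)
have int_fin : (\int[P]_w (loss w)%:E)%E \is a fin_num.
  rewrite ge0_fin_numE; last by apply: integral_ge0 => w _; rewrite lee_fin.
  by apply: le_lt_trans (bound _ (in_L1_0 x)) _; rewrite ltry.
rewrite -(fineK int_fin) lee_fin -ler_pdivrMl// -lerBlDr.
apply: lb_le_inf.
  by exists (objective x lam fx (fun=> 0)), (fun=> 0) => //; exact: in_L1_0.
move=> _ [h hL <-]; rewrite lerBlDr ler_pdivrMl// mulrDr -lee_fin fineK//.
exact: bound.
Qed.
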